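(* Let $\varphi\in[0,\pi)$, $c_1,c_2\in\mathbb{C}$, $c_1\neq c_2$, and let $\mathcal{S}$ be the closed strip in $\mathbb{C}$ bounded by the (distinct, parallel) lines $L_{\varphi,c_1}$ and $L_{\varphi,c_2}$, where $L_{\varphi,c}=\{ae^{i\varphi}+c : a\in\mathbb{R}\}$. Let $l<m$ be integers, $h\in\mathbb{C}\setminus\{0\}$, $a_l,\dots,a_m\in\mathbb{C}$ with $a_la_m\neq0$, and let $$T(p)(x)=\sum_{k=l}^m a_k\,p(x-kh),\qquad p\in\mathbb{C}[x].$$ Then $T$ preserves the set of polynomials with all roots in $\mathcal{S}$ if and only if the following conditions hold: 1) $h=\beta e^{i(\frac{\pi}{2}+\varphi)}$ for some $\beta\in\mathbb{R}\setminus\{0\}$ (that is, $\arg h=\varphi\pm\frac{\pi}{2}$); 2) $l=-m$; 3) all the zeros in $\mathbb{C}\setminus\{0\}$ of the generating function $Q(t)=\sum_{k=l}^m a_kt^k$ lie on the unit circle $\{z\in\mathbb{C}:|z|=1\}$. If, in addition to conditions 1)--3), the width of the strip $\mathcal{S}$ does not exceed $\frac{|h|}{2}$, then for every polynomial $p$ with all roots in $\mathcal{S}$ such that $T(p)\not\equiv0$, all the roots of $T(p)$ are simple.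
   Context: Polynomials have complex coefficients. The zero polynomial is admitted as an image: ''$T$ preserves the set of polynomials with all roots in $\mathcal{S}$'' means that for every nonzero $p$ with all roots in $\mathcal{S}$ (nonzero constants included), $T(p)$ is identically zero or has all its roots in $\mathcal{S}$. The width of the strip is the distance between its two boundary lines. *)

(* Defs.v *)
From HB Require Import structures.
From mathcomp Require Import all_boot all_order all_algebra.
From mathcomp Require Import all_classical all_reals all_analysis.
From mathcomp Require Import complex.

Set Implicit Arguments.
Unset Strict Implicit.
Unset Printing Implicit Defensive.

Import Order.TTheory GRing.Theory Num.Theory.
Import ComplexField.Normc.

Local Open Scope classical_set_scope.
Local Open Scope ring_scope.
Local Open Scope complex_scope.

(* In this file [normc : R[i] -> R] is the real-valued modulus, whereas the
   generic norm [`|z|] of [z : R[i]] is [(normc z)%:C : R[i]]. *)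

Definition expi (R : realType) (theta : R) : R[i] :=
  cos theta +i* sin theta.

Definition line (R : realType) (phi : R) (c : R[i]) : set R[i] :=
  [set z | exists a : R, z = a%:C * expi phi + c].

(* The closed region between two parallel lines: the union of all segments
   joining a point of one line to a point of the other. *)
Definition strip (R : realType) (phi : R) (c1 c2 : R[i]) : set R[i] :=
  [set z | exists z1 z2 (t : R),
    [/\ line phi c1 z1, line phi c2 z2, 0 <= t <= 1
      & z = (1 - t)%:C * z1 + t%:C * z2]].

Definition strip_width (R : realType) (phi : R) (c1 c2 : R[i]) : R :=
  inf [set d | exists z1 z2,
    [/\ line phi c1 z1, line phi c2 z2 & d = normc (z1 - z2)]].

(* The integers l, l + 1, ..., m, for l <= m. *)
Definition int_range (l m : int) : seq int :=
  [seq l + j%:Z | j <- iota 0 `|m - l|%N.+1].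

Lemma mem_int_range (l m k : int) :
  l <= m -> (k \in int_range l m) = (l <= k <= m).
Proof.
move=> lm; apply/mapP/andP => [[j] | [lk km]].
  rewrite mem_iota add0n ltnS => /andP[_ jm] ->.
  by rewrite lerDl -lerBrDl -[m - l]gez0_abs ?subr_ge0// lez_nat.
exists `|k - l|%N; last by rewrite gez0_abs ?subr_ge0// [RHS]addrC subrK.
by rewrite mem_iota leq0n add0n ltnS -lez_nat !gez0_abs ?subr_ge0// lerD2r.
Qed.

Lemma int_range_uniq (l m : int) : uniq (int_range l m).
Proof.
rewrite map_inj_uniq ?iota_uniq// => i j /addrI.
by case.
Qed.

Definition shift_op (R : realType) (l m : int) (h : R[i]) (a : int -> R[i])
    (p : {poly R[i]}) : {poly R[i]} :=
  \sum_(k <- int_range l m) a k *: (p \Po ('X - (k%:~R * h)%:P)).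

(* Negative powers of t occur when l < 0, so this is only meaningful for
   t != 0. *)
Definition gen_fun (R : realType) (l m : int) (a : int -> R[i]) (t : R[i]) :
    R[i] :=
  \sum_(k <- int_range l m) a k * t ^ k.

(* Only meant for nonzero p: every point is a root of the zero polynomial. *)
Definition all_roots_in (R : realType) (S : set R[i]) (p : {poly R[i]}) :=
  forall z, root p z -> S z.

Definition preserves_roots_in (R : realType) (S : set R[i])
    (T : {poly R[i]} -> {poly R[i]}) :=
  forall p, p != 0 -> all_roots_in S p -> T p = 0 \/ all_roots_in S (T p).

Definition all_roots_simple (R : realType) (p : {poly R[i]}) :=
  forall z, root p z -> mup z p = 1%N.

Definition strip_conditions (R : realType) (phi : R) (l m : int) (h : R[i])
    (a : int -> R[i]) :=
  [/\ exists2 beta : R, beta != 0 & h = beta%:C * expi (pi / 2 + phi),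
      l = - m
    & forall t, t != 0 -> gen_fun l m a t = 0 -> normc t = 1].

(* Main.v *)
(** Up to the substitution [x -> x - (l + m) h / 2] and a constant, [T] is a
    product of the operators [q(x) |-> q(x - h/2) - r q(x + h/2)], where [r]
    runs over the roots of the generating function.  When [h] is normal to the
    strip, [|r| = 1] and [x] lies outside the strip, one of [x - h/2] and
    [x + h/2] is strictly closer than the other to every root of [q], so the
    two terms have different moduli and [x] is not a root; if the strip is
    narrow, the logarithmic derivatives of [q] at [x - h/2] and [x + h/2]
    differ at every root [x], so the roots are simple.

    Conversely, apply [T] to [(x - c)^n] with [c] on either boundary line: all
    roots of [T(x^n)] lie on the line through [0] in the direction of the
    strip.  After the rotation [h' = h e^(-i phi)] this makes the polynomials
    [P_n(s) = sum_k a_k (1 - k h' s / n)^n] real-rooted, so [|P_n(x + i y)|] is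
    nondecreasing in [|y|].  This monotonicity passes to the limit
    [Q(exp(- h' s))].  A zero off the real axis would thus produce a whole
    segment of zeros, which is impossible because [Q] has finitely many roots.
    So every logarithm of every root of [Q] is a real multiple of [h'];
    comparing two logarithms of the same root shows that [h'] is imaginary, and
    then the roots have modulus [1].  Finally [l + m = 0], since otherwise the
    substitution would move the roots of [T(x^n)] off their line. *)

Require Import Defs.
From mathcomp Require Import all_boot all_order all_algebra.
From mathcomp Require Import all_classical all_reals all_analysis.
From mathcomp Require Import complex.
From mathcomp Require Import ring lra zify.
Import Order.TTheory GRing.Theory Num.Theory.
Import numFieldNormedType.Exports.
Import ComplexField.Normc.
Local Open Scope classical_set_scope.
Local Open Scope ring_scope.
Local Open Scope complex_scope.

(** * Modulus and exponential of complex numbers, with explicit error bounds *)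

Section ComplexExponential.
Context {R : realType}.
Implicit Types (x y : R) (z w : R[i]).

Lemma sqr_normcE z : normc z ^+ 2 = complex.Re z ^+ 2 + complex.Im z ^+ 2.
Proof. by case: z => x y /=; rewrite sqr_sqrtr// addr_ge0 ?sqr_ge0. Qed.

Lemma normc_ge0 z : 0 <= normc z.
Proof. by case: z => x y; exact: sqrtr_ge0. Qed.

Lemma normc_ReIm z : normc z <= `|complex.Re z| + `|complex.Im z|.
Proof.
rewrite -(ler_pXn2r (ltn0Sn 1)) ?nnegrE ?addr_ge0 ?normc_ge0//.
rewrite sqr_normcE sqrrD !real_normK ?num_real// lerD2r lerDl.
by rewrite mulrn_wge0// mulr_ge0.
Qed.

Lemma normc_geIm z : `|complex.Im z| <= normc z.
Proof.
rewrite -(ler_pXn2r (ltn0Sn 1)) ?nnegrE ?normc_ge0//.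
by rewrite sqr_normcE real_normK ?num_real// lerDr sqr_ge0.
Qed.

Lemma normc_geRe z : `|complex.Re z| <= normc z.
Proof.
rewrite -(ler_pXn2r (ltn0Sn 1)) ?nnegrE ?normc_ge0//.
by rewrite sqr_normcE real_normK ?num_real// lerDl sqr_ge0.
Qed.

Lemma normc_real x : normc (x%:C) = `|x|.
Proof. by rewrite /= expr0n addr0 sqrtr_sqr. Qed.

Lemma normc_nat n : normc (n%:R : R[i]) = n%:R.
Proof.
by rewrite -(rmorph_nat (real_complex R)) normc_real ger0_norm.
Qed.

Lemma normcX z n : normc (z ^+ n) = normc z ^+ n.
Proof.
by elim: n => [|n IHn]; rewrite ?normc1// !exprS normcM IHn.
Qed.

Lemma normc_eq0 z : (normc z == 0) = (z == 0).
Proof.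
by apply/eqP/eqP => [/eq0_normc//|->]; rewrite normc0.
Qed.

Lemma normc_expi x : normc (expi x) = 1.
Proof. by rewrite /= cos2Dsin2 sqrtr1. Qed.

Lemma expiD x y : expi (x + y) = expi x * expi y.
Proof.
rewrite /expi cosD sinD; apply/eqP; rewrite eq_complex /=.
by rewrite eqxx /= addrC.
Qed.

Lemma sin_le_id x : 0 <= x -> `|sin x| <= x.
Proof.
move=> x0; have dsin y : y \in `]0, x[ -> is_derive y 1 (@sin R) (cos y).
  by move=> _; exact: is_derive_sin.
have csin : {within `[0, x], continuous (@sin R)}.
  by apply: continuous_subspaceT => y; exact: continuous_sin.
have [c _] := MVT_segment x0 dsin csin.
rewrite sin0 !subr0 => ->; rewrite normrM (ger0_norm x0).
by rewrite ler_piMl// cos_max.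
Qed.

Lemma oneBcos_le x : `|cos x - 1| <= x ^+ 2 / 2.
Proof.
have -> : cos x - 1 = - (2 * sin (`|x| / 2) ^+ 2).
  have {1}-> : cos x = cos (`|x| / 2 *+ 2).
    by rewrite -mulr_natr divfK ?pnatr_eq0// cos_norm.
  by rewrite cos_mulr2n cos2sin2; ring.
rewrite normrN normrM normrX gtr0_norm// -[x ^+ 2]real_normK ?num_real//.
have x0 : 0 <= `|x| / 2 by rewrite divr_ge0.
have := sin_le_id _ x0; have := normr_ge0 (sin (`|x| / 2)).
set s := `|sin _|; set t := `|x| => s0 st.
have : s ^+ 2 <= (t / 2) ^+ 2 by rewrite ler_pXn2r ?nnegrE.
by lra.
Qed.

Lemma sinB_id_le x : `|sin x - x| <= `|x| ^+ 3 / 2.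
Proof.
wlog x0 : x / 0 <= x => [hw|].
  have [/hw//|/ltW xneg] := leP 0 x.
  have := hw (- x); rewrite oppr_ge0 sinN normrN opprK addrC distrC; exact.
have dsin y : y \in `]0, x[ -> is_derive y 1 (@sin R - id) (cos y - 1).
  by move=> _; apply: is_deriveB.
have csin : {within `[0, x], continuous (@sin R - id)}.
  apply: continuous_subspaceT => y; apply: cvgB; last exact: cvg_id.
  exact: continuous_sin.
have [c cx] := MVT_segment x0 dsin csin.
rewrite /= !fctE sin0 !subr0 => ->; rewrite normrM !(ger0_norm x0).
have := oneBcos_le c; move: cx; rewrite in_itv /= => /andP[c0 cx].
have : c ^+ 2 <= x ^+ 2 by rewrite ler_pXn2r ?nnegrE.
move=> c2 hc; rewrite exprSr mulrAC ler_wpM2r//.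
by rewrite (le_trans hc)// ler_pM2r ?invr_gt0.
Qed.

(** The upper bound comes from [expR x * (1 - x) <= expR x * expR (- x) = 1], with
    [1 - x >= 1/2]. *)
Lemma expR_taylor1 x : `|x| <= 1 / 2 -> `|expR x - 1 - x| <= 2 * x ^+ 2.
Proof.
move=> hx; have h1 := expR_ge1Dx x; have h2 := expR_ge1Dx (- x).
have h3 := expRxMexpNx_1 x; have hpos := expR_gt0 x.
move: hx; rewrite ler_norml => /andP[hx1 hx2].
rewrite ger0_norm; last by lra.
have h4 : expR x * (1 - x) <= 1.
  by rewrite -[leRHS]h3 ler_wpM2l// ltW.
have h5 : (expR x - 1 - x) * (1 - x) <= x ^+ 2 by nra.
by nra.
Qed.

Definition cexp z : R[i] := (expR (complex.Re z))%:C * expi (complex.Im z).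

Lemma cexpD z w : cexp (z + w) = cexp z * cexp w.
Proof.
case: z w => a b [c d]; rewrite /cexp /= expRD expiD rmorphM/=; ring.
Qed.

Lemma cexp0 : cexp 0 = 1.
Proof. by rewrite /cexp /= expR0 /expi cos0 sin0 mul1r. Qed.

Lemma cexpMn n z : cexp (n%:R * z) = cexp z ^+ n.
Proof.
elim: n => [|n IHn]; first by rewrite mul0r cexp0.
by rewrite -natr1 mulrDl mul1r cexpD IHn exprSr.
Qed.

Lemma normc_cexp z : normc (cexp z) = expR (complex.Re z).
Proof.
by rewrite /cexp normcM normc_expi mulr1 normc_real ger0_norm// expR_ge0.
Qed.

Lemma cexp_neq0 z : cexp z != 0.
Proof. by rewrite -normc_eq0 normc_cexp expR_eq0. Qed.

Lemma cexpN z : cexp (- z) = (cexp z)^-1.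
Proof.
by apply: (mulfI (cexp_neq0 z)); rewrite -cexpD subrr cexp0 divff// cexp_neq0.
Qed.

Lemma cexpMz (k : int) z : cexp (k%:~R * z) = cexp z ^ k.
Proof.
case: k => n; first exact: cexpMn.
by rewrite NegzE mulrNz mulNr cexpN cexpMn exprnN.
Qed.

Lemma cexp_2pi : cexp (0 +i* (pi *+ 2)) = 1.
Proof. by rewrite /cexp /= expR0 /expi cos2pi sin2pi mul1r. Qed.

(** Polar form: the logarithm of the modulus, and an angle found by [acos] from the real part of
    [z / |z|], signed like the imaginary part. *)
Lemma cexp_surj z : z != 0 -> exists w, cexp w = z.
Proof.
move=> z0; have r0 : 0 < normc z by rewrite lt_def normc_eq0 z0 normc_ge0.
have [r er] := expR_total r0.
set v := z / (normc z)%:C.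
have rC0 : (normc z)%:C != 0 :> R[i] by rewrite eq_complex /= gt_eqF.
have v1 : normc v = 1.
  by rewrite /v normcM normcV normc_real ger0_norm ?normc_ge0// divff ?gt_eqF.
have [th ev] : exists th, expi th = v.
  have v2 := sqr_normcE v; rewrite v1 expr1n in v2.
  case: v v1 v2 => a b /= _ v2.
  have a1 : -1 <= a <= 1.
    rewrite -ler_norml -(ler_pXn2r (ltn0Sn 1)) ?nnegrE//.
    by rewrite real_normK ?num_real// expr1n v2 lerDl sqr_ge0.
  have ab : Num.sqrt (1 - a ^+ 2) = `|b|.
    by rewrite [1]v2 addrAC subrr add0r sqrtr_sqr.
  have a1' : a \in `[(-1), 1] by rewrite in_itv.
  have [b0|b0] := leP 0 b.
    by exists (acos a); rewrite /expi sin_acos// ab acosK// ger0_norm.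
  exists (- acos a); rewrite /expi cosN sinN sin_acos// ab acosK//.
  by rewrite ltr0_norm// opprK.
exists (r +i* th); rewrite /cexp /= er ev /v mulrC divfK//.
Qed.

Lemma cexp_taylor1 z : normc z <= 1 / 2 ->
  normc (cexp z - 1 - z) <= 3 * normc z ^+ 2.
Proof.
move=> hz; have hx := le_trans (normc_geRe z) hz.
have hy := le_trans (normc_geIm z) hz; rewrite sqr_normcE.
apply: le_trans (normc_ReIm _) _; clear hz.
case: z hx hy => x y /= hx hy.
have hE := expR_taylor1 x hx; have hC := oneBcos_le y; have hS := sinB_id_le y.
rewrite !(mul0r, subr0, addr0, oppr0).
have hy2 : `|y| ^+ 2 = y ^+ 2 by rewrite real_normK ?num_real.
have hx2 : `|x| ^+ 2 = x ^+ 2 by rewrite real_normK ?num_real.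
have e2 : 0 <= expR x <= 2.
  rewrite expR_ge0 /=; move: hE hx; rewrite !ler_norml => /andP[_ ? /andP[? ?]].
  by nra.
have hE1 : `|expR x - 1| <= 2 * `|x|.
  have -> : expR x - 1 = expR x - 1 - x + x by ring.
  apply: le_trans (ler_normD _ _) _; rewrite -hx2 in hE.
  have := normr_ge0 x; by nra.
have hR : `|expR x * cos y - 1 - x| <= 2 * x ^+ 2 + y ^+ 2.
  have -> : expR x * cos y - 1 - x = (expR x - 1 - x) + expR x * (cos y - 1).
    by ring.
  apply: le_trans (ler_normD _ _) _; rewrite lerD// normrM.
  move/andP: e2 => [e0 e2]; rewrite (ger0_norm e0).
  have := normr_ge0 (cos y - 1); by nra.
have hI : `|expR x * sin y - y| <= y ^+ 2 / 2 + 2 * `|x| * `|y|.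
  have -> : expR x * sin y - y = expR x * (sin y - y) + (expR x - 1) * y.
    by ring.
  apply: le_trans (ler_normD _ _) _; rewrite !normrM lerD//; last first.
    by rewrite ler_wpM2r.
  move/andP: e2 => [e0 e2]; rewrite (ger0_norm e0).
  have h3 : `|y| ^+ 3 <= y ^+ 2 / 2.
    by rewrite exprSr hy2 ler_wpM2l ?sqr_ge0//; lra.
  have := normr_ge0 (sin y - y); by nra.
(* This is [2|x||y| <= x^2 + y^2], which absorbs the mixed term into the constant 3. *)
have h0 : 0 <= (`|x| - `|y|) ^+ 2 by rewrite sqr_ge0.
rewrite -hx2 -hy2 in hR hI *.
have hxy : 0 <= `|x| ^+ 2 by rewrite sqr_ge0.
have hyy : 0 <= `|y| ^+ 2 by rewrite sqr_ge0.
by nra.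
Qed.

(** The Taylor bound gives [|z| <= 3|z|^2], impossible for [0 < |z| <= 1/4]. *)
Lemma cexp_eq1 z : normc z <= 1 / 4 -> cexp z = 1 -> z = 0.
Proof.
move=> hz e1; have hz2 : normc z <= 1 / 2 by lra.
have := cexp_taylor1 z hz2; rewrite e1 subrr add0r normcN => h.
apply: eq0_normc; have := normc_ge0 z; by nra.
Qed.

Lemma normc_subX (z w : R[i]) (M : R) n : normc z <= M -> normc w <= M ->
  normc (z ^+ n.+1 - w ^+ n.+1) <= n.+1%:R * normc (z - w) * M ^+ n.
Proof.
move=> hz hw; have M0 : 0 <= M := le_trans (normc_ge0 z) hz.
elim: n => [|n IHn]; first by rewrite mul1r mulr1 !expr1.
have -> : z ^+ n.+2 - w ^+ n.+2 =
    z * (z ^+ n.+1 - w ^+ n.+1) + (z - w) * w ^+ n.+1.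
  by rewrite [z ^+ n.+2]exprS [w ^+ n.+2]exprS; ring.
apply: le_trans (le_normcD _ _) _.
rewrite !normcM normcX -[n.+2%:R]natr1 mulrDl mul1r mulrDl lerD//.
  by rewrite [M ^+ _]exprS [leRHS]mulrCA ler_pM ?normc_ge0.
by rewrite ler_wpM2l ?normc_ge0// lerXn2r ?nnegrE ?normc_ge0.
Qed.

(** With [w = z / (n + 1)], [cexp z] is the power [cexp w ^+ n.+1]. The bases [1 + w] and [cexp w]
    differ by at most [3|w|^2], and [normc_subX] multiplies this by at most [(n + 1) e^|z|]. *)
Lemma cexp_lim z (n : nat) : 2 * normc z <= n.+1%:R ->
  normc ((1 + z / n.+1%:R) ^+ n.+1 - cexp z)
    <= 3 * normc z ^+ 2 * expR (normc z) / n.+1%:R.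
Proof.
move=> hn; set w := z / n.+1%:R.
have n0 : 0 < n.+1%:R :> R by rewrite ltr0n.
have nw : normc w = normc z / n.+1%:R.
  rewrite /w normcM normcV; congr (_ / _).
  by rewrite normc_nat.
have zw : z = n.+1%:R * w by rewrite /w mulrCA divff ?mulr1// pnatr_eq0.
have w2 : normc w <= 1 / 2.
  by rewrite nw ler_pdivrMr//; lra.
rewrite [in cexp z]zw cexpMn.
have b1 : normc (1 + w) <= expR (normc w).
  apply: le_trans (le_normcD _ _) _; rewrite normc1; exact: expR_ge1Dx.
have b2 : normc (cexp w) <= expR (normc w).
  rewrite normc_cexp ler_expR; apply: le_trans (normc_geRe w).
  exact: ler_norm.
apply: le_trans (normc_subX _ _ _ _ b1 b2) _.
have -> : 1 + w - cexp w = - (cexp w - 1 - w) by ring.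
rewrite normcN.
have hM : expR (normc w) ^+ n <= expR (normc z).
  rewrite -expRM_natl ler_expR nw mulrA ler_pdivrMr// mulrC.
  by rewrite ler_wpM2l ?normc_ge0// ler_nat.
have ht := cexp_taylor1 w w2.
rewrite -mulrA.
apply: (@le_trans _ _ (n.+1%:R * (3 * normc w ^+ 2 * expR (normc z)))).
  by rewrite (ler_wpM2l (ltW n0))// ler_pM ?normc_ge0 ?exprn_ge0 ?expR_ge0.
rewrite nw le_eqVlt; apply/orP; left; apply/eqP; field.
by rewrite gt_eqF.
Qed.

End ComplexExponential.

(** * Exponential sums as limits of real-rooted polynomials *)

Section ExponentialSums.
Context {R : realType}.
Implicit Types (x y : R) (z w s : R[i]) (p : {poly R[i]}).

Lemma normc_prod (I : Type) (r : seq I) (F : I -> R[i]) :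
  normc (\prod_(i <- r) F i) = \prod_(i <- r) normc (F i).
Proof.
by elim/big_rec2: _ => [|i u v _ <-]; rewrite ?normc1// normcM.
Qed.

Lemma real_rooted_normc_mono p x y y' :
  p = 0 \/ (forall z, root p z -> complex.Im z = 0) -> `|y| <= `|y'| ->
  normc p.[x +i* y] <= normc p.[x +i* y'].
Proof.
move=> [->|hp] yy'; first by rewrite !horner0.
have [->|p0] := eqVneq p 0; first by rewrite !horner0.
have [r pE] := closed_field_poly_normal p.
have hr z : z \in r -> complex.Im z = 0.
  move=> zr; apply: hp; rewrite pE rootZ ?lead_coef_eq0//.
  by rewrite root_prod_XsubC.
rewrite pE !hornerZ !horner_prod !normcM ler_wpM2l ?normc_ge0//.
rewrite !normc_prod !big_seq; apply: ler_prod => z zr.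
rewrite normc_ge0 /= !hornerXsubC -(ler_pXn2r (ltn0Sn 1)) ?nnegrE ?normc_ge0//.
rewrite !sqr_normcE; have := hr z zr; case: z {zr} => u v /= ->; rewrite !subr0.
rewrite lerD2l -(real_normK (num_real y)) -(real_normK (num_real y')).
by rewrite lerXn2r.
Qed.

Lemma ler0_invn x (K : R) (N : nat) :
  (forall n, (N <= n)%N -> x <= K / n.+1%:R) -> x <= 0.
Proof.
move=> h; rewrite leNgt; apply/negP => x0.
pose n := maxn N (Num.bound `|K / x|).
have := h n (leq_maxl _ _); rewrite ler_pdivlMr ?ltr0n// => hn.
have : K / x < n.+1%:R.
  apply: le_lt_trans (ler_norm _) _.
  apply: lt_le_trans (archi_boundP (normr_ge0 _)) _.
  by rewrite ler_nat leqW// leq_maxr.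
rewrite ltr_pdivrMr// mulrC => /(le_lt_trans hn).
by rewrite ltxx.
Qed.

Section Sum.
Variables (I : Type) (r : seq I) (c f : I -> R[i]).

Definition expsum s := \sum_(i <- r) c i * cexp (f i * s).

(** Euler's approximation of each exponential; the index [n.+1] avoids a division by zero. *)
Definition expsum_poly (n : nat) :=
  \sum_(i <- r) c i *: (1 + (f i / n.+1%:R) *: 'X) ^+ n.+1.

Lemma horner_expsum_poly n s :
  (expsum_poly n).[s] = \sum_(i <- r) c i * (1 + f i * s / n.+1%:R) ^+ n.+1.
Proof.
rewrite /expsum_poly horner_sum; apply: eq_bigr => i _.
by rewrite !hornerE mulrAC.
Qed.

Lemma expsum_lim s : exists (K : R) (N : nat), forall n, (N <= n)%N ->
  normc ((expsum_poly n).[s] - expsum s) <= K / n.+1%:R.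
Proof.
suff [K [N h]] : exists (K : R) (N : nat), forall n, (N <= n)%N ->
    normc (\sum_(i <- r) c i * (1 + f i * s / n.+1%:R) ^+ n.+1
           - \sum_(i <- r) c i * cexp (f i * s)) <= K / n.+1%:R.
  by exists K, N => n /h; rewrite horner_expsum_poly.
elim: r => [|i r' [K [N h]]].
  by exists 0, 0%N => n _; rewrite !big_nil subrr normc0 mul0r.
pose b := normc (f i * s).
pose K' := normc (c i) * (3 * b ^+ 2 * expR b).
(* The second threshold gives [2 |f i * s| <= n + 1], as [cexp_lim] requires. *)
exists (K' + K), (maxn N (Num.bound (2 * b))) => n.
rewrite geq_max => /andP[Nn bn]; rewrite !big_cons.
set X := (1 + _) ^+ _; set S1 := \sum_(j <- r') _; set S2 := \sum_(j <- r') _.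
have -> : c i * X + S1 - (c i * cexp (f i * s) + S2) =
    c i * (X - cexp (f i * s)) + (S1 - S2) by ring.
apply: le_trans (le_normcD _ _) _; rewrite mulrDl lerD ?h//.
rewrite normcM /K' -[leRHS]mulrA ler_wpM2l ?normc_ge0// /X cexp_lim//.
have b0 : 0 <= 2 * b by rewrite mulr_ge0 ?normc_ge0.
apply: le_trans (ltW (archi_boundP b0)) _.
by rewrite ler_nat (leq_trans bn).
Qed.

(** At stage [n] the modulus at [x + iy'] is at most the one at [x + iy], which is [O(1/n)]. *)
Lemma expsum_zero_segment x y y' :
  (forall n, expsum_poly n = 0 \/
     (forall z, root (expsum_poly n) z -> complex.Im z = 0)) ->
  `|y'| <= `|y| -> expsum (x +i* y) = 0 -> expsum (x +i* y') = 0.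
Proof.
move=> hreal yy' E0; apply: eq0_normc; apply: le_anti; rewrite normc_ge0 andbT.
have [K [N h]] := expsum_lim (x +i* y).
have [K' [N' h']] := expsum_lim (x +i* y').
apply: (@ler0_invn _ (K + K') (maxn N N')) => n.
rewrite geq_max => /andP[/h {}h /h' {}h']; rewrite mulrDl.
rewrite E0 subr0 in h.
set p := expsum_poly n in h h'.
have hm := real_rooted_normc_mono p x y' y (hreal n) yy'.
have -> : expsum (x +i* y') = p.[x +i* y'] - (p.[x +i* y'] - expsum (x +i* y')).
  by ring.
apply: le_trans (le_normcD _ _) _; rewrite normcN lerD//.
exact: le_trans hm h.
Qed.

End Sum.

(** Otherwise [size p] sample points of the segment have distinct exponentials that are all roots of
    [p], more than its degree allows. *)
Lemma cexp_segment_nonroot p w z : p != 0 -> z != 0 ->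
  exists2 t : R, 0 <= t <= 1 & ~~ root p (cexp (w + t%:C * z)).
Proof.
move=> p0 z0; apply: contrapT => hn.
have hroot t : 0 <= t <= 1 -> root p (cexp (w + t%:C * z)).
  by move=> t01; apply/negPn/negP => hr; apply: hn; exists t.
have nz : 0 < normc z by rewrite lt_def normc_eq0 z0 normc_ge0.
have N0 : 0 < (size p)%:R :> R by rewrite ltr0n size_poly_gt0.
(* This spacing keeps the samples [j * d] in [[0, 1]] and any two exponents within [1/4] of each
   other, so that [cexp_eq1] separates their exponentials. *)
pose d : R := ((size p)%:R * (1 + 4 * normc z))^-1.
have d0 : 0 < d by rewrite invr_gt0 mulr_gt0//; lra.
have dN : (size p)%:R * d * (1 + 4 * normc z) = 1.
  by rewrite /d mulrAC mulfV// gt_eqF// -invr_gt0.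
pose rs := [seq cexp (w + (j%:R * d)%:C * z) | j <- iota 0 (size p)].
suff : (size rs < size p)%N by rewrite size_map size_iota ltnn.
apply: max_poly_roots => //.
  apply/allP => _ /mapP[j + ->]; rewrite mem_iota add0n => /andP[_ jp].
  apply: hroot; rewrite mulr_ge0 ?ler0n ?(ltW d0)//=.
  apply: (@le_trans _ _ ((size p)%:R * d)).
    by rewrite ler_wpM2r ?(ltW d0)// ler_nat ltnW.
  have : 0 < (size p)%:R * d by rewrite mulr_gt0.
  by nra.
rewrite map_inj_in_uniq ?iota_uniq// => j k.
rewrite !mem_iota !add0n => /andP[_ jp] /andP[_ kp] ejk.
pose e : R := (j%:R - k%:R) * d.
have ejk1 : cexp (e%:C * z) = 1.
  apply: (mulfI (cexp_neq0 (w + (k%:R * d)%:C * z))).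
  rewrite mulr1 -cexpD -ejk; congr cexp.
  by rewrite /e mulrBl rmorphB /=; ring.
have e4 : normc (e%:C * z) <= 1 / 4.
  rewrite normcM normc_real /e normrM (ger0_norm (ltW d0)).
  have jk : `|j%:R - k%:R| <= (size p)%:R :> R.
    have [jk|kj] := leqP j k.
      rewrite distrC ger0_norm ?subr_ge0 ?ler_nat// lerBlDr.
      by rewrite -natrD ler_nat; lia.
    rewrite ger0_norm ?subr_ge0 ?ler_nat ?(ltnW kj)// lerBlDr.
    by rewrite -natrD ler_nat; lia.
  have : `|j%:R - k%:R| * d <= (size p)%:R * d by rewrite ler_wpM2r ?(ltW d0).
  have : 0 < (size p)%:R * d by rewrite mulr_gt0.
  by nra.
move/eqP: (cexp_eq1 _ e4 ejk1).
rewrite mulf_eq0 (negbTE z0) orbF /e => /eqP [] /eqP.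
by rewrite mulf_eq0 (gt_eqF d0) orbF subr_eq0 eqr_nat => /eqP.
Qed.

End ExponentialSums.

(** * Factorisation of the shift operator into half steps *)

Section HalfStepOperators.
Context {R : realType}.
Implicit Types (x y z w h c r : R[i]) (p q Q : {poly R[i]}).

Lemma poly_horner_inj p q : (forall x, p.[x] = q.[x]) -> p = q.
Proof.
move=> pq; apply/eqP; rewrite -subr_eq0; apply: contraT => /closed_nonrootP[x].
by rewrite /root hornerD hornerN pq subrr eqxx.
Qed.

Definition half_step h r q : {poly R[i]} :=
  (q \Po ('X - (h / 2)%:P)) - r *: (q \Po ('X + (h / 2)%:P)).

Lemma horner_half_step h r q x :
  (half_step h r q).[x] = q.[x - h / 2] - r * q.[x + h / 2].
Proof. by rewrite /half_step !hornerE !horner_comp !hornerE. Qed.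

Lemma half_step0 h r : half_step h r 0 = 0.
Proof. by rewrite /half_step !comp_poly0 scaler0 subr0. Qed.

(** The value at [x] of [Q(E) p], where [E] is the translation [p(x) -> p(x - h)]; composing
    operators amounts to multiplying the polynomials [Q]. *)
Definition shift_sum h Q p x := \sum_(i < size Q) Q`_i * p.[x - i%:R * h].

Lemma shift_sum_widen h Q p x (n : nat) : (size Q <= n)%N ->
  shift_sum h Q p x = \sum_(i < n) Q`_i * p.[x - i%:R * h].
Proof.
move=> Qn; rewrite /shift_sum.
rewrite (big_ord_widen n (fun i => Q`_i * p.[x - i%:R * h]) Qn) big_mkcond /=.
apply: eq_bigr => i _; case: ltnP => // Qi.
by rewrite nth_default// mul0r.
Qed.

Lemma shift_sum1 h p x : shift_sum h 1 p x = p.[x].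
Proof.
by rewrite /shift_sum size_poly1 big_ord1 coef1 eqxx !mul1r mul0r subr0.
Qed.

Lemma shift_sumZ h c Q p x : shift_sum h (c *: Q) p x = c * shift_sum h Q p x.
Proof.
rewrite (shift_sum_widen _ _ _ _ _ (size_scale_leq c Q)) mulr_sumr.
by apply: eq_bigr => i _; rewrite coefZ mulrA.
Qed.

Lemma shift_sum_XsubC h r Q p x :
  shift_sum h (('X - r%:P) * Q) p x =
  shift_sum h Q p (x - h) - r * shift_sum h Q p x.
Proof.
have sz : (size (('X - r%:P) * Q)%R <= (size Q).+1)%N.
  by apply: leq_trans (size_polyMleq _ _) _; rewrite size_XsubC.
rewrite (shift_sum_widen _ _ _ _ _ sz).
rewrite [in RHS](shift_sum_widen _ _ _ x _ (leqnSn _)).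
under eq_bigr do rewrite mulrBl coefB mulrBl coefXM coefCM.
rewrite big_split /= big_ord_recl /= mul0r add0r.
congr (_ + _).
  apply: eq_bigr => i _ /=; congr (_ * p.[_]).
  have -> : bump 0 i = i.+1 by [].
  by rewrite -natr1; ring.
by rewrite sumrN mulr_sumr; congr (- _); apply: eq_bigr => i _; rewrite mulrA.
Qed.

(** Since [E - r = E^(1/2) (E^(1/2) - r E^(-1/2))], each linear factor gives one half step, and the
    leftover half translations add up to the shift of the argument. *)
Lemma shift_sum_prod h (rs : seq R[i]) p x :
  shift_sum h (\prod_(r <- rs) ('X - r%:P)) p x =
  (foldr (half_step h) p rs).[x - (size rs)%:R * h / 2].
Proof.
elim: rs x => [|r rs IHrs] x.
  by rewrite big_nil shift_sum1 /= !mul0r subr0.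
rewrite big_cons shift_sum_XsubC !IHrs /= horner_half_step -natr1.
by congr (_.[_] - _ * _.[_]); field.
Qed.

Lemma horner_shift_op (l m : int) h (a : int -> R[i]) p x :
  (shift_op l m h a p).[x] =
  \sum_(k <- int_range l m) a k * p.[x - k%:~R * h].
Proof.
rewrite /shift_op horner_sum; apply: eq_bigr => k _.
by rewrite hornerZ horner_comp !hornerE.
Qed.

(** This is [t^(-l) Q(t)], a genuine polynomial with the same nonzero roots as the generating
    function. *)
Definition gen_poly (l m : int) (a : int -> R[i]) : {poly R[i]} :=
  \poly_(j < `|m - l|%N.+1) a (l + j%:Z).

Section GenPoly.
Variables (l m : int) (a : int -> R[i]).
Hypotheses (hlm : l < m) (ha : a l * a m != 0).

Lemma big_int_range (F : int -> R[i]) :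
  \sum_(k <- int_range l m) F k = \sum_(j < `|m - l|%N.+1) F (l + j%:Z).
Proof. by rewrite /int_range big_map -[iota 0 _]/(index_iota 0 _.+1) big_mkord. Qed.

Let al0 : a l != 0.
Proof. by move: ha; rewrite mulf_eq0 negb_or => /andP[]. Qed.
Let am0 : a m != 0.
Proof. by move: ha; rewrite mulf_eq0 negb_or => /andP[]. Qed.
Let lmE : l + `|m - l|%N%:Z = m.
Proof. by rewrite gez0_abs ?subr_ge0 ?(ltW hlm)//; ring. Qed.

Lemma size_gen_poly : size (gen_poly l m a) = `|m - l|%N.+1.
Proof. by rewrite size_poly_eq//= lmE. Qed.

Lemma gen_poly_neq0 : gen_poly l m a != 0.
Proof. by rewrite -size_poly_eq0 size_gen_poly. Qed.

Lemma lead_coef_gen_poly : lead_coef (gen_poly l m a) = a m.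
Proof. by rewrite lead_coefE size_gen_poly coef_poly ltnSn lmE. Qed.

Lemma root0_gen_poly : ~~ root (gen_poly l m a) 0.
Proof. by rewrite /root horner_coef0 coef_poly /= addr0. Qed.

Lemma gen_funE t : t != 0 -> gen_fun l m a t = t ^ l * (gen_poly l m a).[t].
Proof.
move=> t0; rewrite /gen_fun big_int_range horner_poly mulr_sumr.
by apply: eq_bigr => j _; rewrite expfzDr// mulrCA.
Qed.

Lemma gen_fun_root t : t != 0 ->
  (gen_fun l m a t == 0) = root (gen_poly l m a) t.
Proof.
by move=> t0; rewrite gen_funE// mulf_eq0 expfz_eq0 (negbTE t0) andbF.
Qed.

Lemma shift_op_factor h : exists2 rs : seq R[i],
    (0 < size rs)%N /\ (forall t, t \in rs = root (gen_poly l m a) t) &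
  forall p, shift_op l m h a p = a m *: (foldr (half_step h) p rs \Po
    ('X - ((l + m)%:~R * h / 2)%:P)).
Proof.
have [rs QE] := closed_field_poly_normal (gen_poly l m a).
rewrite lead_coef_gen_poly in QE.
have sz : size rs = `|m - l|%N.
  apply: succn_inj; rewrite -size_gen_poly QE size_scale//.
  by rewrite size_prod_XsubC.
exists rs; first split.
- by rewrite sz absz_gt0 subr_eq0 gt_eqF.
- by move=> t; rewrite QE rootZ// root_prod_XsubC.
move=> p; apply: poly_horner_inj => x.
rewrite horner_shift_op big_int_range hornerZ horner_comp !hornerE.
(* The translation by [l h] of the lowest term and the [m - l] half translations of the factors add
   up to [(l + m) h / 2]. *)
have -> : x - (l + m)%:~R * h / 2 = x - l%:~R * h - (size rs)%:R * h / 2.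
  have -> : (size rs)%:R = (m - l)%:~R :> R[i].
    by rewrite sz -[in RHS](@gez0_abs (m - l)) ?subr_ge0 ?ltW// pmulrn.
  by rewrite !rmorphD rmorphN /=; field.
rewrite -shift_sum_prod -shift_sumZ -QE /shift_sum size_gen_poly.
apply: eq_bigr => j _; rewrite coef_poly ltn_ord; congr (_ * p.[_]).
by rewrite rmorphD /=; ring.
Qed.

End GenPoly.

(** A factor [(X - z)^2] of [p] would make [p'] vanish at [z]. *)
Lemma mup_simple_root p z : root p z -> ~~ root p^`() z -> mup z p = 1%N.
Proof.
move=> pz p'z; have p0 : p != 0.
  by apply: contraNneq p'z => ->; rewrite deriv0 root0.
apply/eqP; rewrite eqn_leq -XsubC_dvd// dvdp_XsubCl pz andbT.
rewrite mup_leq//; apply: contra p'z => /dvdpP[g ->].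
rewrite /root derivM deriv_exp derivXsubC !hornerE subrr /=.
by apply/eqP; ring.
Qed.

(** Covers a [q] without roots, for which the comparison of moduli has no factor to work on. *)
Lemma root_half_step_const h r c x :
  root (half_step h r c%:P) x -> half_step h r c%:P = 0.
Proof.
move=> /rootP hx; apply: poly_horner_inj => y; rewrite horner0 -hx.
by rewrite !horner_half_step !hornerC.
Qed.

(** * Height: the signed distance from the line through 0 in the direction [phi] *)

Definition height (phi : R) z : R :=
  complex.Im z * cos phi - complex.Re z * sin phi.

Section Height.
Variable phi : R.

Lemma heightD z w : height phi (z + w) = height phi z + height phi w.
Proof. by case: z w => ? ? [? ?]; rewrite /height /=; ring. Qed.

Lemma heightN z : height phi (- z) = - height phi z.
Proof. by case: z => ? ?; rewrite /height /=; ring. Qed.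

Lemma heightB z w : height phi (z - w) = height phi z - height phi w.
Proof. by rewrite heightD heightN. Qed.

Lemma heightZ (t : R) z : height phi (t%:C * z) = t * height phi z.
Proof. by case: z => ? ?; rewrite /height /=; ring. Qed.

Lemma expi_pihalf : expi (pi / 2 + phi) = 'i * expi phi.
Proof.
by rewrite expiD /expi cos_pihalf sin_pihalf.
Qed.

Lemma height_expi : height phi (expi phi) = 0.
Proof. by rewrite /height /= mulrC subrr. Qed.

Lemma height_normal : height phi (expi (pi / 2 + phi)) = 1.
Proof.
rewrite expi_pihalf /height /=; have := cos2Dsin2 phi; lra.
Qed.

Lemma height0P z : height phi z = 0 -> exists t : R, z = t%:C * expi phi.
Proof.
case: z => x y; rewrite /height /= => h0.
exists (x * cos phi + y * sin phi); apply/eqP; rewrite eq_complex /=.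
have c2 := cos2Dsin2 phi.
rewrite !mul0r subr0 addr0; apply/andP; split; apply/eqP.
  transitivity (x * cos phi ^+ 2 + y * cos phi * sin phi
      - (y * cos phi - x * sin phi) * sin phi); last by rewrite h0; ring.
  by rewrite -[LHS]mulr1 -c2; ring.
transitivity (x * cos phi * sin phi + y * sin phi ^+ 2
    + (y * cos phi - x * sin phi) * cos phi); last by rewrite h0; ring.
by rewrite -[LHS]mulr1 -c2; ring.
Qed.

(** [height] and [x cos phi + y sin phi] are orthogonal coordinates of [z], so their squares add up
    to [|z|^2]. *)
Lemma normc_height z : `|height phi z| <= normc z.
Proof.
rewrite -(ler_pXn2r (ltn0Sn 1)) ?nnegrE ?normc_ge0// real_normK ?num_real//.
rewrite sqr_normcE /height; set x := complex.Re z; set y := complex.Im z.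
have -> : x ^+ 2 + y ^+ 2 = (x ^+ 2 + y ^+ 2) * (cos phi ^+ 2 + sin phi ^+ 2).
  by rewrite cos2Dsin2 mulr1.
by have := sqr_ge0 (x * cos phi + y * sin phi); nra.
Qed.

(** * Half steps along the normal of the strip *)

Section NormalStep.
Variables (beta : R) (h : R[i]).
Hypothesis hE : h = beta%:C * expi (pi / 2 + phi).

Lemma half_normal_step : h / 2 = (beta / 2)%:C * expi (pi / 2 + phi).
Proof. by rewrite hE rmorphM fmorphV rmorph_nat mulrAC. Qed.

Lemma height_step : height phi h = beta.
Proof. by rewrite hE heightZ height_normal mulr1. Qed.

(* [2 beta height w] is the difference of the squared moduli. *)
Lemma normc_half_step_lt w : 0 < beta * height phi w ->
  normc (w - h / 2) < normc (w + h / 2).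
Proof.
move=> w0; rewrite -(ltr_pXn2r (ltn0Sn 1)) ?nnegrE ?normc_ge0// -subr_gt0.
have -> : normc (w + h / 2) ^+ 2 - normc (w - h / 2) ^+ 2 =
    2 * (beta * height phi w).
  rewrite half_normal_step !sqr_normcE expi_pihalf /height; case: w {w0} => x y /=.
  by field.
by rewrite mulr_gt0.
Qed.

Lemma prod_normc_half_step_lt (zs : seq R[i]) x :
  (0 < size zs)%N -> {in zs, forall z, 0 < beta * height phi (x - z)} ->
  \prod_(z <- zs) normc (x - h / 2 - z) < \prod_(z <- zs) normc (x + h / 2 - z).
Proof.
move=> zs0 hzs; rewrite big_seq [ltRHS]big_seq; apply: ltr_prod.
  by case: zs zs0 {hzs} => // z zs _; rewrite /= mem_head.
move=> z /hzs /normc_half_step_lt; rewrite normc_ge0 /=.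
by rewrite [x - z - _]addrAC [x - z + _]addrAC.
Qed.

End NormalStep.

Section NormalStepRoots.
Variables (beta : R) (h r : R[i]) (q : {poly R[i]}) (A B : R).
Hypotheses (beta0 : beta != 0) (hE : h = beta%:C * expi (pi / 2 + phi)).
Hypotheses (r1 : normc r = 1) (q0 : q != 0).
Hypothesis hq : forall z, root q z -> A <= height phi z <= B.

Lemma half_step_roots : half_step h r q = 0 \/
  (forall z, root (half_step h r q) z -> A <= height phi z <= B).
Proof.
have [->|F0] := eqVneq (half_step h r q) 0; [by left|right=> x Fx].
have [zs qE] := closed_field_poly_normal q.
set c := lead_coef q in qE.
have c0 : c != 0 by rewrite lead_coef_eq0.
have hzs z : z \in zs -> A <= height phi z <= B.
  by move=> zzs; apply: hq; rewrite qE rootZ// root_prod_XsubC.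
have zs0 : (0 < size zs)%N.
  rewrite lt0n; apply: contraNneq F0 => /size0nil zs0.
  have qc : q = c%:P by rewrite qE zs0 big_nil alg_polyC.
  by move: Fx; rewrite qc => /root_half_step_const ->.
(* At a root the two terms have equal moduli, and [|r| = 1] removes [r]. *)
have eqm : \prod_(z <- zs) normc (x - h / 2 - z) =
    \prod_(z <- zs) normc (x + h / 2 - z).
  move/rootP: Fx; rewrite horner_half_step => /eqP; rewrite subr_eq0 => /eqP.
  move/(congr1 (@normc R)); rewrite normcM r1 mul1r qE !hornerZ !normcM.
  move/mulfI => /(_ _); rewrite normc_eq0 => /(_ c0).
  rewrite !horner_prod !normc_prod.
  have XsubE y : \prod_(z <- zs) normc ('X - z%:P).[y] =
      \prod_(z <- zs) normc (y - z).
    by apply: eq_bigr => z _; rewrite hornerXsubC.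
  by rewrite !XsubE.
(* Replacing [h] by [- h] swaps [x - h/2] and [x + h/2], so one inequality serves both sides of the
   strip. *)
have hEN : - h = (- beta)%:C * expi (pi / 2 + phi).
  by rewrite hE rmorphN mulNr.
have lt1 := prod_normc_half_step_lt _ _ hE zs x zs0.
have lt2 := prod_normc_half_step_lt _ _ hEN zs x zs0.
rewrite mulNr opprK eqm in lt2; rewrite eqm in lt1.
have noall (s : R) : s != 0 ->
    ~ {in zs, forall z, 0 < s * (beta * height phi (x - z))}.
  rewrite neq_lt => /orP[s0|s0] hs.
    suff : false by [].
    rewrite -(ltxx (\prod_(z <- zs) normc (x + h / 2 - z))).
    apply: lt2 => z zzs.
    by have := hs z zzs; nra.
  suff : false by [].
  rewrite -(ltxx (\prod_(z <- zs) normc (x + h / 2 - z))); apply: lt1 => z zzs.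
  by have := hs z zzs; rewrite pmulr_rgt0.
have b2 : 0 < beta * beta by rewrite -expr2 exprn_even_gt0.
apply/andP; split; rewrite leNgt; apply/negP => hx.
  apply: (noall (- beta)); rewrite ?oppr_eq0// => z /hzs/andP[Az _].
  rewrite heightB mulNr mulrA -mulrN mulr_gt0// opprB subr_gt0.
  exact: lt_le_trans hx Az.
apply: (noall beta) => // z /hzs/andP[_ zB].
by rewrite heightB mulrA mulr_gt0// subr_gt0 (le_lt_trans zB).
Qed.

Lemma deriv_prod_XsubC (zs : seq R[i]) x : {in zs, forall z, x != z} ->
  (\prod_(z <- zs) ('X - z%:P))^`().[x] =
  (\prod_(z <- zs) ('X - z%:P)).[x] * \sum_(z <- zs) (x - z)^-1.
Proof.
elim: zs => [_|z zs IHzs hx].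
  by rewrite !big_nil mulr0 derivC horner0.
rewrite !big_cons derivM derivXsubC !hornerE IHzs; last first.
  by move=> w wzs; apply: hx; rewrite inE wzs orbT.
have xz : x - z != 0 by rewrite subr_eq0; apply: hx; rewrite mem_head.
by field.
Qed.

(** Write [w^-1] as [conj w / |w|^2]. The sign of the rotated inverse thus tells on which side of
    the line through 0 the point [w] lies. *)
Lemma Im_inv_mul_expi w :
  complex.Im (w^-1 * expi phi) = - height phi w / normc w ^+ 2.
Proof.
rewrite sqr_normcE /height; case: w => x y /=; ring.
Qed.

(* At a double root [x] the logarithmic derivatives of [q] at [x - h/2] and
   [x + h/2] agree, but they lie on opposite sides of the direction of the
   strip. *)
Lemma half_step_simple x : B - A <= `|beta| / 2 -> half_step h r q != 0 ->
  root (half_step h r q) x -> ~~ root (half_step h r q)^`() x.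
Proof.
move=> BA F0 Fx; apply/negP => F'x.
have [/eqP|/(_ _ Fx)/andP[Ax xB]] := half_step_roots.
  by rewrite (negbTE F0).
have [zs qE] := closed_field_poly_normal q.
set c := lead_coef q in qE.
have c0 : c != 0 by rewrite lead_coef_eq0.
have hzs z : z \in zs -> A <= height phi z <= B.
  by move=> zzs; apply: hq; rewrite qE rootZ// root_prod_XsubC.
have zs0 : (0 < size zs)%N.
  rewrite lt0n; apply: contraNneq F0 => /size0nil zs0.
  have qc : q = c%:P by rewrite qE zs0 big_nil alg_polyC.
  by move: Fx; rewrite qc => /root_half_step_const ->.
have e0 : q.[x - h / 2] = r * q.[x + h / 2].
  by apply/eqP; rewrite -subr_eq0 -horner_half_step.
have e1 : q^`().[x - h / 2] = r * q^`().[x + h / 2].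
  apply/eqP; rewrite -subr_eq0 -horner_half_step.
  move: F'x; rewrite /half_step derivB derivZ !deriv_comp derivXsubC.
  by rewrite derivD derivX derivC addr0 !mulr1.
have h2 : height phi (h / 2) = beta / 2.
  by rewrite (half_normal_step _ _ hE) heightZ height_normal mulr1.
have bb : 0 < `|beta| by rewrite normr_gt0.
have r0 : r != 0 by rewrite -normc_eq0 r1 oner_eq0.
(* Otherwise [x - h/2] and [x + h/2] are both roots of [q], at heights [|beta|] apart, while
   [B - A <= |beta| / 2]. *)
have qv : q.[x + h / 2] != 0.
  apply/eqP => qv; move: e0; rewrite qv mulr0 => /rootP/hq.
  move/rootP/hq: qv; rewrite heightB heightD h2 => /andP[? ?] /andP[? ?].
  have : `|beta| <= B - A by rewrite ler_norml; lra.
  by lra.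
have qu : q.[x - h / 2] != 0 by rewrite e0 mulf_neq0.
have ne y : q.[y] != 0 -> {in zs, forall z, y != z}.
  move=> qy z zzs; apply: contraNneq qy => ->.
  by apply/eqP/rootP; rewrite qE rootZ// root_prod_XsubC.
have logq y : q.[y] != 0 -> q^`().[y] / q.[y] = \sum_(z <- zs) (y - z)^-1.
  move=> qy; apply: (mulIf qy); rewrite divfK// mulrC [in LHS]qE [in RHS]qE.
  by rewrite derivZ !hornerZ deriv_prod_XsubC ?mulrA//; exact: ne.
(* Dividing [e1] by [e0] cancels [r]: the logarithmic derivatives agree. *)
have : \sum_(z <- zs) (x - h / 2 - z)^-1 = \sum_(z <- zs) (x + h / 2 - z)^-1.
  by rewrite -!logq// e0 e1 -mulf_div divff// mul1r.
move/(congr1 (fun s => complex.Im (s * expi phi))).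
rewrite !mulr_suml.
have ImS (f : R[i] -> R[i]) : complex.Im (\sum_(z <- zs) f z) =
    \sum_(z <- zs) complex.Im (f z).
  by elim/big_rec2: _ => // z u v _ <-; case: (f z) v => [? ?] [? ?].
rewrite !ImS => /eqP; rewrite -subr_eq0 -sumrB => /eqP hs.
suff : 0 < beta * \sum_(z <- zs) (complex.Im ((x - h / 2 - z)^-1 * expi phi)
                         - complex.Im ((x + h / 2 - z)^-1 * expi phi)).
  by rewrite hs mulr0 ltxx.
rewrite mulr_sumr.
have pos z : z \in zs -> 0 < beta *
    (complex.Im ((x - h / 2 - z)^-1 * expi phi)
     - complex.Im ((x + h / 2 - z)^-1 * expi phi)).
  move=> zzs; rewrite !Im_inv_mul_expi.
  have nu : 0 < (normc (x - h / 2 - z) ^+ 2)^-1.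
    rewrite invr_gt0 exprn_gt0// lt_def normc_ge0 normc_eq0 subr_eq0 andbT.
    exact: (ne _ qu).
  have nv : 0 < (normc (x + h / 2 - z) ^+ 2)^-1.
    rewrite invr_gt0 exprn_gt0// lt_def normc_ge0 normc_eq0 subr_eq0 andbT.
    exact: (ne _ qv).
  rewrite !heightB !heightD h2; have /andP[Az zB] := hzs z zzs.
  set nu' := _^-1 in nu *; set nv' := _^-1 in nv *.
  set t := height phi x in Ax xB *; set s := height phi z in Az zB *.
  (* The heights [t] and [s] both lie in [[A, B]], hence differ by at most [|beta| / 2]; this makes
     the coefficients of [nu'] and [nv'] below nonnegative. *)
  have ts : `|beta * (t - s)| <= beta ^+ 2 / 2.
    have ts' : `|t - s| <= B - A by rewrite ler_norml; lra.
    rewrite normrM -(real_normK (num_real beta)) expr2 -mulrA.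
    by rewrite ler_wpM2l//; lra.
  move: ts; rewrite ler_norml => /andP[ts1 ts2].
  have b2 : 0 < beta ^+ 2 by rewrite exprn_even_gt0.
  have -> : beta * (- (t - beta / 2 - s) * nu' - - (t + beta / 2 - s) * nv') =
     (beta ^+ 2 / 2 - beta * (t - s)) * nu'
     + (beta ^+ 2 / 2 + beta * (t - s)) * nv' by field.
  (* The two coefficients add up to [beta ^+ 2], so at most one vanishes, even at the extreme width;
     the sign of [beta * (t - s)] singles out a positive one. *)
  have [ts3|ts3] := ltP 0 (beta * (t - s)).
    rewrite ltr_wpDl// ?mulr_ge0 ?mulr_gt0 ?(ltW nu) ?subr_ge0//.
    by rewrite ltr_wpDl// ?divr_gt0// ?ltW//; lra.
  rewrite ltr_pwDl// ?mulr_gt0 ?mulr_ge0 ?(ltW nv)//; lra.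
clear - zs0 pos.
case: zs zs0 pos => // z zs _ pos; rewrite big_cons ltr_pwDl ?pos ?mem_head//.
by rewrite big_seq sumr_ge0// => w wzs; rewrite ltW// pos// inE wzs orbT.
Qed.

End NormalStepRoots.

End Height.

End HalfStepOperators.

(** * Lines, strip and width in terms of heights *)

Section StripGeometry.
Context {R : realType}.
Variables (phi : R).
Implicit Types (c z : R[i]).

Lemma line_height c z : line phi c z <-> height phi z = height phi c.
Proof.
split=> [[t ->]|zc]; first by rewrite heightD heightZ height_expi mulr0 add0r.
have /height0P[t tE] : height phi (z - c) = 0 by rewrite heightB zc subrr.
by exists t; rewrite -tE subrK.
Qed.

Lemma height_neq c1 c2 : line phi c1 <> line phi c2 ->
  height phi c1 != height phi c2.
Proof.
move=> hl; apply/eqP => h12; apply: hl; apply/seteqP; split=> z /line_height.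
  by rewrite h12 => /line_height.
by rewrite -h12 => /line_height.
Qed.

Lemma strip_height c1 c2 z : height phi c1 != height phi c2 ->
  strip phi c1 c2 z <->
  Num.min (height phi c1) (height phi c2) <= height phi z
    <= Num.max (height phi c1) (height phi c2).
Proof.
set H1 := height phi c1; set H2 := height phi c2 => H12; split.
  move=> [z1 [z2 [t [/line_height z1E /line_height z2E /andP[t0 t1] ->]]]].
  rewrite heightD !heightZ z1E z2E -/H1 -/H2.
  by have [h12|h12] := leP H1 H2; apply/andP; split; nra.
set H := height phi z => hH.
(* The endpoints are the projections of [z] along the normal [n] onto the two lines, and [t] is its
   relative height between them. *)
pose n := expi (pi / 2 + phi).
pose t := (H - H1) / (H2 - H1).
have d0 : H2 - H1 != 0 by rewrite subr_eq0 eq_sym.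
have tE : (1 - t) * H1 + t * H2 = H by rewrite /t; field.
exists (z - (H - H1)%:C * n), (z - (H - H2)%:C * n), t; split.
- by apply/line_height; rewrite heightB heightZ height_normal mulr1 subKr.
- by apply/line_height; rewrite heightB heightZ height_normal mulr1 subKr.
- move: hH; rewrite /t; have [h12|h12] := leP H1 H2.
    have d1 : 0 < H2 - H1 by rewrite lt_def d0 subr_ge0.
    by rewrite ler_pdivlMr// ler_pdivrMr// mul0r mul1r subr_ge0 lerD2r.
  have d1 : H2 - H1 < 0 by rewrite subr_lt0.
  by rewrite ler_ndivlMr// ler_ndivrMr// mul0r mul1r subr_le0 lerD2r andbC.
- have tC : (1 - t)%:C = 1 - t%:C :> R[i] by rewrite rmorphB rmorph1.
  have -> : (1 - t)%:C * (z - (H - H1)%:C * n) + t%:C * (z - (H - H2)%:C * n) =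
      z - ((1 - t)%:C * (H - H1)%:C + t%:C * (H - H2)%:C) * n.
    by rewrite tC; ring.
  rewrite -!rmorphM -rmorphD -[in (1 - t) * (H - H1)]tE -[in t * (H - H2)]tE.
  have -> : (1 - t) * ((1 - t) * H1 + t * H2 - H1)
      + t * ((1 - t) * H1 + t * H2 - H2) = 0 by ring.
  by rewrite rmorph0 mul0r subr0.
Qed.

(** A segment is at least as long as the difference of heights of its ends, which bounds every
    distance in the infimum. *)
Lemma strip_width_ge c1 c2 :
  `|height phi c1 - height phi c2| <= strip_width phi c1 c2.
Proof.
apply: lb_le_inf.
  exists (normc (c1 - c2)), c1, c2.
  by split => //; apply/line_height.
move=> _ [z1 [z2 [/line_height <- /line_height <- ->]]].
by rewrite -heightB normc_height.
Qed.

End StripGeometry.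

(** * Linearity, translations, derivatives and nonvanishing of the operator *)

Section ShiftOperator.
Context {R : realType}.
Variables (l m : int) (h : R[i]) (a : int -> R[i]).
Hypotheses (hlm : l < m) (ha : a l * a m != 0) (h0 : h != 0).
Let T := shift_op l m h a.
Implicit Types (p q : {poly R[i]}) (c z : R[i]).

Lemma shift_opD p q : T (p + q) = T p + T q.
Proof.
apply: poly_horner_inj => x; rewrite hornerD !horner_shift_op -big_split.
by apply: eq_bigr => k _; rewrite hornerD mulrDr.
Qed.

Lemma shift_opZ c p : T (c *: p) = c *: T p.
Proof.
apply: poly_horner_inj => x; rewrite hornerZ !horner_shift_op mulr_sumr.
by apply: eq_bigr => k _; rewrite hornerZ mulrCA.
Qed.

Lemma shift_op_comp p z : T (p \Po ('X - z%:P)) = T p \Po ('X - z%:P).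
Proof.
apply: poly_horner_inj => x; rewrite horner_comp !horner_shift_op.
apply: eq_bigr => k _; rewrite horner_comp !hornerXsubC; congr (_ * p.[_]).
by ring.
Qed.

Lemma deriv_shift_op p : (T p)^`() = T p^`().
Proof.
rewrite /T /shift_op (big_morph _ (@derivD _) (@deriv0 _)); apply: eq_bigr => k _.
by rewrite derivZ deriv_comp derivXsubC mulr1.
Qed.

(** The witness vanishes at each node [- k h] with [k != m], so at 0 only [a m * p(- m h)] survives;
    [h != 0] keeps the nodes distinct. *)
Lemma shift_op_neq0 : exists p, T p != 0.
Proof.
pose p : {poly R[i]} :=
  \prod_(k <- int_range l m | k != m) ('X - (- (k%:~R * h))%:P).
have pk k : k \in int_range l m -> k != m -> p.[- (k%:~R * h)] = 0.
  move=> kr km; rewrite /p horner_prod (big_rem k)//= km hornerXsubC subrr.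
  by rewrite mul0r.
exists p; apply: contra_neq ha => /(congr1 (fun q => q.[0])).
rewrite horner0 horner_shift_op (bigD1_seq m) ?int_range_uniq//=; last first.
  by rewrite mem_int_range; [rewrite lexx|]; rewrite ltW.
rewrite big_seq_cond big1 ?addr0 => [|k /andP[kr km]]; last first.
  by rewrite sub0r pk// mulr0.
move/eqP; rewrite sub0r mulf_eq0 => /orP[/eqP->|]; first by rewrite mulr0.
rewrite /p horner_prod prodf_seq_eq0 => /hasP[k _ /andP[km]].
rewrite hornerXsubC opprK addrC -mulrBl mulf_eq0 (negbTE h0) orbF.
by rewrite -rmorphB intr_eq0 subr_eq0 (negbTE km).
Qed.

(** Otherwise every [T(x^(n+1))] is constant. Differentiating, which commutes with [T], gives
    [T(x^n) = 0] for all [n], hence [T = 0]. *)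
Lemma shift_op_Xn_root : exists n z, T 'X^n != 0 /\ root (T 'X^n) z.
Proof.
apply: contrapT => hn; have [p /eqP] := shift_op_neq0; apply.
have TXn n : T 'X^n = 0.
  have dT : (T 'X^(n.+1))^`() = 0.
    have [->|TX0] := eqVneq (T 'X^(n.+1)) 0; first by rewrite deriv0.
    have [/closed_rootP[z rz]|] := boolP (size (T 'X^(n.+1)) != 1)%N.
      by case: hn; exists n.+1, z.
    by rewrite negbK => /size_poly1P[c _ ->]; rewrite derivC.
  move: dT; rewrite deriv_shift_op derivXn -scaler_nat shift_opZ => /eqP.
  by rewrite scaler_eq0 pnatr_eq0 => /eqP.
have T0 : T 0 = 0 by have := shift_opZ 0 0; rewrite !scale0r.
rewrite -[p]coefK poly_def; elim/big_ind: _ => //.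
  by move=> q r; rewrite shift_opD => -> ->; rewrite addr0.
by move=> i _; rewrite shift_opZ TXn scaler0.
Qed.

End ShiftOperator.

(** * Sufficiency: products of half steps keep the strip *)

Section Sufficiency.
Context {R : realType}.
Variables (phi beta : R) (h : R[i]) (A B : R).
Hypotheses (beta0 : beta != 0) (hE : h = beta%:C * expi (pi / 2 + phi)).

(** The zero alternative is carried through the induction, since an intermediate image may
    vanish. *)
Lemma foldr_half_step_roots (rs : seq R[i]) (p : {poly R[i]}) :
  {in rs, forall r, normc r = 1} ->
  p = 0 \/ (forall z, root p z -> A <= height phi z <= B) ->
  foldr (half_step h) p rs = 0 \/
    (forall z, root (foldr (half_step h) p rs) z -> A <= height phi z <= B).
Proof.
elim: rs => //= r rs IHrs hr hp.
have hrs : {in rs, forall r, normc r = 1}.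
  by move=> s srs; apply: hr; rewrite inE srs orbT.
have [->|hq] := IHrs hrs hp; first by left; rewrite half_step0.
have [->|q0] := eqVneq (foldr (half_step h) p rs) 0.
  by left; rewrite half_step0.
by apply: (half_step_roots phi beta) => //; apply: hr; rewrite mem_head.
Qed.

End Sufficiency.

(** * Necessity: conditions forced by the images of monomials *)

Section Necessity.
Context {R : realType}.
Variables (phi : R) (l m : int) (h : R[i]) (a : int -> R[i]).
Hypotheses (hlm : l < m) (ha : a l * a m != 0) (h0 : h != 0).
Hypothesis hT : forall n, shift_op l m h a 'X^n = 0 \/
  (forall z, root (shift_op l m h a 'X^n) z -> height phi z = 0).
Implicit Types (s t w z : R[i]).

Let h' := h / expi phi.
Let f (k : int) := - (k%:~R * h').

Let u0 : expi phi != 0.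
Proof. by rewrite -normc_eq0 normc_expi oner_eq0. Qed.

Let h'0 : h' != 0. Proof. by rewrite mulf_neq0// invr_eq0. Qed.

(* For [s != 0] the substitution [y = (n + 1) e^(i phi) / s] turns
   [expsum_poly n] at [s] into [T(x^(n+1)) / x^(n+1)] at [y]. *)
Lemma real_rooted_expsum_poly n : expsum_poly _ (int_range l m) a f n = 0 \/
  (forall s, root (expsum_poly _ (int_range l m) a f n) s -> complex.Im s = 0).
Proof.
set P := expsum_poly _ _ _ _ _; pose y s := n.+1%:R * expi phi / s.
have n0 : n.+1%:R != 0 :> R[i] by rewrite pnatr_eq0.
have y0 s : s != 0 -> y s != 0 by move=> s0; rewrite !mulf_neq0// invr_eq0.
have PE s : s != 0 -> y s ^+ n.+1 * P.[s] = (shift_op l m h a 'X^(n.+1)).[y s].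
  move=> s0; rewrite horner_expsum_poly horner_shift_op mulr_sumr.
  apply: eq_bigr => k _; rewrite mulrCA hornerXn -exprMn; congr (_ * _ ^+ _).
  rewrite /y /f /h'; field.
  by rewrite s0 u0 nat1r n0.
have [T0|hroots] := hT n.+1; [left|right=> s].
  (* [PE] holds away from 0; the factor ['X] takes care of [s = 0]. *)
  have : P * 'X = 0.
    apply: poly_horner_inj => s; rewrite hornerM hornerX horner0.
    have [->|s0] := eqVneq s 0; first by rewrite mulr0.
    apply: (mulfI (expf_neq0 n.+1 (y0 s s0))).
    by rewrite mulrA PE// T0 horner0 mul0r mulr0.
  by move/eqP; rewrite mulf_eq0 polyX_eq0 orbF => /eqP.
have [->//|s0] := eqVneq s 0 => /rootP Ps.
have /hroots/height0P[x xE] : root (shift_op l m h a 'X^(n.+1)) (y s).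
  by apply/rootP; rewrite -PE// Ps mulr0.
have x0 : x%:C != 0 :> R[i].
  by apply: contraNneq (y0 s s0) => x0; rewrite xE x0 mul0r.
have -> : s = (n.+1%:R / x)%:C.
  rewrite rmorphM fmorphV rmorph_nat; apply: (mulIf x0); rewrite divfK//.
  apply: (mulIf u0); rewrite -mulrA -xE /y; field.
  exact: s0.
by [].
Qed.

Lemma expsum_gen_fun s :
  expsum _ (int_range l m) a f s = gen_fun l m a (cexp (- (h' * s))).
Proof.
apply: eq_bigr => k _; rewrite -cexpMz; congr (_ * cexp _).
by rewrite /f; ring.
Qed.

Lemma gen_fun_log_real s : gen_fun l m a (cexp (- (h' * s))) = 0 ->
  complex.Im s = 0.
Proof.
case: s => x y /= hs; apply/eqP; apply: contraT => y0.
have P0 := gen_poly_neq0 l m a hlm ha.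
have z0 : - (h' * (0 +i* y)) != 0.
  by rewrite oppr_eq0 mulf_neq0// eq_complex /= negb_and y0 orbT.
(* Some point [x + ity] of the segment from [x] to [x + iy] is not a zero of [Q(exp(- h' s))],
   against the spreading of the zero [x + iy] over that segment. *)
have [t /andP[t0 t1]] := cexp_segment_nonroot _ (- (h' * x%:C)) _ P0 z0.
have -> : - (h' * x%:C) + t%:C * - (h' * (0 +i* y)) = - (h' * (x +i* (t * y))).
  have -> : x +i* (t * y) = x%:C + t%:C * (0 +i* y).
    apply/eqP; rewrite eq_complex /= !(mul0r, mulr0, subr0, addr0, add0r).
    by rewrite !eqxx.
  by ring.
rewrite -gen_fun_root ?cexp_neq0// -expsum_gen_fun; case/eqP.
apply: (expsum_zero_segment _ _ _ _ _ y _ real_rooted_expsum_poly).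
  by rewrite normrM ler_piMl// ger0_norm.
by rewrite expsum_gen_fun.
Qed.

Lemma gen_fun_root_unit t : t != 0 -> gen_fun l m a t = 0 ->
  (exists2 beta : R, beta != 0 & h = beta%:C * expi (pi / 2 + phi)) /\
  normc t = 1.
Proof.
move=> t0 t_root; have [w wE] := cexp_surj t t0.
have Im0 z : cexp z = t -> complex.Im (- z / h') = 0.
  by move=> zE; apply: gen_fun_log_real; rewrite mulrCA divff// mulr1 opprK zE.
have s0 := Im0 w wE.
(* A second logarithm of the same root: the difference of the two shows that [2 i pi / h'] is a real
   number [d]. *)
have s1 : complex.Im (- (w + (0 +i* (pi *+ 2))) / h') = 0.
  by apply: Im0; rewrite cexpD cexp_2pi mulr1.
have [x xE] : exists x : R, - w / h' = x%:C.
  by move: s0; case: (- w / h') => x y /= ->; exists x.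
have [d dE] : exists d : R, (0 +i* (pi *+ 2)) / h' = d%:C.
  have -> : (0 +i* (pi *+ 2)) / h' =
      - w / h' - - (w + (0 +i* (pi *+ 2))) / h' by field.
  move: s0 s1; case: (- w / h') => x1 y1; case: (- _ / h') => x2 y2 /= -> ->.
  by exists (x1 - x2); apply/eqP; rewrite eq_complex /= subrr !eqxx.
have pi2 : pi *+ 2 != 0 :> R by rewrite mulrn_eq0 /= gt_eqF ?pi_gt0.
have I0 : (0 +i* (pi *+ 2)) != 0 :> R[i].
  by rewrite eq_complex /= negb_and pi2 orbT.
have d0 : d != 0.
  apply: contraNneq I0 => d0; move: dE; rewrite d0 => /eqP.
  by rewrite mulf_eq0 invr_eq0 (negbTE h'0) orbF.
have dC0 : d%:C != 0 :> R[i] by rewrite fmorph_eq0.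
have IE v : (0 +i* v) = v%:C * 'i :> R[i].
  apply/eqP; rewrite eq_complex /= !(mul0r, mulr0, mulr1, subr0, addr0).
  by rewrite !eqxx.
have h'E : h' = ((pi *+ 2) / d)%:C * 'i.
  apply: (mulIf dC0); rewrite [RHS]mulrAC -rmorphM divfK// -IE -dE mulrC.
  by rewrite divfK.
split.
  exists (pi *+ 2 / d); first by rewrite mulf_neq0// invr_eq0.
  by rewrite expi_pihalf mulrA -h'E /h' divfK.
rewrite -wE normc_cexp.
(* [w] is a real multiple of the imaginary number [h'], so its real part is 0. *)
have -> : w = - x%:C * h' by rewrite -xE !mulNr opprK divfK.
rewrite h'E /= !(mul0r, mulr0, mulr1, subr0, addr0, add0r, oppr0).
by rewrite expR0.
Qed.

(** [gen_poly] has degree [m - l > 0] and a nonzero constant term. *)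
Lemma gen_fun_root_exists : exists2 t, t != 0 & gen_fun l m a t = 0.
Proof.
have /closed_rootP[t tr] : size (gen_poly l m a) != 1%N.
  by rewrite size_gen_poly// eqSS absz_eq0 subr_eq0 gt_eqF.
have t0 : t != 0.
  by apply: contraTneq tr => ->; exact: root0_gen_poly.
by exists t => //; apply/eqP; rewrite gen_fun_root.
Qed.

Lemma shift_op_Xn_conditions : strip_conditions phi l m h a.
Proof.
have [t0 t00 t0r] := gen_fun_root_exists.
have [[beta beta0 hE] _] := gen_fun_root_unit _ t00 t0r.
have hunit t : t != 0 -> gen_fun l m a t = 0 -> normc t = 1.
  by move=> t1 /(gen_fun_root_unit _ t1)[].
split=> //; first by exists beta.
have [n [z [TX0 Tz]]] := shift_op_Xn_root l m h a hlm ha h0.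
have [rs [_ rsE] /(_ 'X^n) TE] := shift_op_factor l m a hlm ha h.
have hrs : {in rs, forall r, normc r = 1}.
  move=> r; rewrite rsE => rr; have r0 : r != 0.
    by apply: contraTneq rr => ->; exact: root0_gen_poly.
  by apply: hunit => //; apply/eqP; rewrite gen_fun_root.
have hX : 'X^n = 0 :> {poly R[i]} \/
    (forall z, root ('X^n) z -> 0 <= height phi z <= 0).
  right=> y; rewrite /root hornerXn expf_eq0 => /andP[_ /eqP->].
  by rewrite /height !mul0r subrr lexx.
have am0 : a m != 0 by move: ha; rewrite mulf_eq0 negb_or => /andP[].
(* Sufficiency with the degenerate strip [A = B = 0] puts the roots of the product, before
   recentring, on the line through 0. *)
have [F0|hF] := foldr_half_step_roots phi beta h 0 0 beta0 hE rs _ hrs hX.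
  by move: TX0; rewrite TE F0 comp_poly0 scaler0 eqxx.
have hz : height phi z = 0.
  by have [TX|] := hT n; [rewrite TX eqxx in TX0|apply].
(* Both [z] and [z - (l + m) h / 2] have height 0, while [h] has height [beta != 0]. *)
have := hF (z - (l + m)%:~R * h / 2).
have -> : root (foldr (half_step h) 'X^n rs) (z - (l + m)%:~R * h / 2).
  by move: Tz; rewrite TE rootZ// /root horner_comp hornerXsubC.
move=> /(_ isT)/le_anti.
have -> : (l + m)%:~R * h / 2 = ((l + m)%:~R / 2)%:C * h.
  by rewrite rmorphM fmorphV rmorph_nat rmorph_int mulrAC.
rewrite heightB hz sub0r heightZ (height_step phi beta h hE) => /esym/eqP.
rewrite oppr_eq0 !mulf_eq0 (negbTE beta0) orbF invr_eq0 pnatr_eq0 orbF intr_eq0.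
by rewrite addr_eq0 => /eqP.
Qed.

End Necessity.

(** * From the boundary lines to monomials, then the equivalence and simplicity *)

Lemma preserves_Xn_roots (R : realType) (phi : R) (c1 c2 : R[i])
    (l m : int) (h : R[i]) (a : int -> R[i]) (n : nat) :
  height phi c1 != height phi c2 ->
  preserves_roots_in (strip phi c1 c2) (shift_op l m h a) ->
  shift_op l m h a 'X^n = 0 \/
  (forall z, root (shift_op l m h a 'X^n) z -> height phi z = 0).
Proof.
move=> H12 hpres; set S := shift_op l m h a 'X^n.
have [->|S0] := eqVneq S 0; [by left|right=> z Sz].
(* [T] commutes with translations, so the image of [(x - c)^n] has the root [z + c]. *)
have hc c : Num.min (height phi c1) (height phi c2) <= height phi c
    <= Num.max (height phi c1) (height phi c2) ->
    Num.min (height phi c1) (height phi c2) <= height phi (z + c)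
    <= Num.max (height phi c1) (height phi c2).
  move=> /(strip_height _ _ _ _ H12) cS; apply/(strip_height _ _ _ _ H12).
  pose p : {poly R[i]} := 'X^n \Po ('X - c%:P).
  have pE : shift_op l m h a p = S \Po ('X - c%:P) by exact: shift_op_comp.
  have p0 : p != 0.
    by rewrite /p comp_Xn_poly expf_neq0// polyXsubC_eq0.
  have hp : all_roots_in (strip phi c1 c2) p.
    move=> y; rewrite /root horner_comp hornerXn hornerXsubC expf_eq0.
    by move=> /andP[_]; rewrite subr_eq0 => /eqP ->.
  have [Tp0|] := hpres p p0 hp.
    case/eqP: S0; apply: poly_horner_inj => x.
    by rewrite horner0 -(horner0 (x + c)) -Tp0 pE horner_comp hornerXsubC addrK.
  by apply; rewrite pE /root horner_comp hornerXsubC addrK.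
(* As [z + c1] and [z + c2] both stay between the boundaries, [z] is neither above nor below height
   0. *)
have := hc c1; have := hc c2; rewrite !heightD.
by have [h12|h12] := leP (height phi c1) (height phi c2);
  rewrite !lexx ?(ltW h12) ?h12 /= => /(_ isT)/andP[? ?] /(_ isT)/andP[? ?];
  lra.
Qed.

Theorem theorem1p10 (R : realType) (phi : R) (c1 c2 : R[i])
    (l m : int) (h : R[i]) (a : int -> R[i])
    (hphi : 0 <= phi < pi)
    (hc : c1 != c2)
    (hlines : line phi c1 <> line phi c2)
    (hlm : l < m)
    (hh : h != 0)
    (ha : a l * a m != 0) :
  (preserves_roots_in (strip phi c1 c2) (shift_op l m h a)
     <-> strip_conditions phi l m h a)
  /\
  (strip_conditions phi l m h a ->
   strip_width phi c1 c2 <= normc h / 2 ->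
   forall p : {poly R[i]}, all_roots_in (strip phi c1 c2) p ->
     shift_op l m h a p != 0 -> all_roots_simple (shift_op l m h a p)).
Proof.
have H12 := height_neq phi c1 c2 hlines.
have stripP z := strip_height phi c1 c2 z H12.
set A := Num.min _ _ in stripP; set B := Num.max _ _ in stripP.
have am0 : a m != 0 by move: ha; rewrite mulf_eq0 negb_or => /andP[].
have [rs [rs0 rsE] factE] := shift_op_factor l m a hlm ha h.
have rs1 : strip_conditions phi l m h a -> {in rs, forall r, normc r = 1}.
  move=> [_ _ hunit] r; rewrite rsE => rr.
  have r0 : r != 0 by apply: contraTneq rr => ->; exact: root0_gen_poly.
  by apply: hunit => //; apply/eqP; rewrite gen_fun_root.
(* The condition [l = - m] cancels the recentring translation. *)
have symE : strip_conditions phi l m h a -> forall p,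
    shift_op l m h a p = a m *: foldr (half_step h) p rs.
  move=> [_ lE _] p; rewrite factE lE addNr !mul0r subr0.
  by rewrite comp_polyXr.
have rootsP p : p != 0 -> all_roots_in (strip phi c1 c2) p ->
    p = 0 \/ (forall z, root p z -> A <= height phi z <= B).
  by move=> p0 hp; right=> z /hp/stripP.
split; first split.
- move=> hpres; apply: shift_op_Xn_conditions => // n.
  exact: preserves_Xn_roots hpres.
- move=> hcond p p0 /(rootsP p p0) hp; rewrite symE//.
  have [[beta beta0 hE] _ _] := hcond.
  have [->|hF] := foldr_half_step_roots _ _ _ _ _ beta0 hE _ _ (rs1 hcond) hp.
    by left; rewrite scaler0.
  right=> z.
  by rewrite rootZ// => /hF/stripP.
move=> hcond hw p hp; have [[beta beta0 hE] _ _] := hcond.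
rewrite symE// scaler_eq0 negb_or => /andP[_ F0] z.
rewrite rootZ// => Fz; apply: mup_simple_root; first by rewrite rootZ.
rewrite derivZ rootZ//.
(* Split off the outermost half step: [q], the image of [p] under the others, still has its roots in
   the strip, and this last step makes the roots simple. *)
have := rs1 hcond; case: rs rs0 F0 Fz {factE symE rsE rs1} => //.
move=> r rs _ F0 Fz hr.
rewrite /= in F0 Fz *; set q := foldr _ _ _ in F0 Fz *.
have q0 : q != 0 by apply: contraNneq F0 => ->; rewrite half_step0.
have p0 : p != 0.
  apply: contraNneq q0 => p0; rewrite /q p0; apply/eqP.
  by elim: (rs) => //= s t ->; rewrite half_step0.
have hrs : {in rs, forall r, normc r = 1}.
  by move=> s srs; apply: hr; rewrite inE srs orbT.
have hpAB := rootsP p p0 hp.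
have [/eqP|hq] := foldr_half_step_roots _ _ _ _ _ beta0 hE _ _ hrs hpAB.
  by rewrite -/q (negbTE q0).
apply: (half_step_simple phi beta h r q A B) => //.
  by apply: hr; rewrite mem_head.
have <- : normc h = `|beta| by rewrite hE normcM normc_expi mulr1 normc_real.
(* [B - A] is the height gap of the boundary lines, at most the width of the strip. *)
apply: le_trans hw; apply: le_trans (strip_width_ge phi c1 c2).
rewrite /A /B; have [h12|h12] := leP (height phi c1) (height phi c2).
  by rewrite distrC ler_norm.
exact: ler_norm.
Qed.
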